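(* Let $N$ be a $2n$-dimensional smooth manifold, $\nabla$ a linear connection on $N$ with torsion tensor $T^{\nabla}$, and $J$ an almost complex structure on $N$. If $d^{\nabla}J=0$, then the Nijenhuis tensor $N_J$ of $J$ satisfies, for all vector fields $X,Y$, $$N_J(X,Y)=-J\big(T^{\nabla}(X,JY)+T^{\nabla}(JX,Y)\big).$$
   Context: An almost complex structure is a $(1,1)$-tensor field $J$ with $J^2=-\mathrm{id}$. $T^{\nabla}(X,Y)=\nabla_XY-\nabla_YX-[X,Y]$, $(\nabla_XJ)Y=\nabla_X(JY)-J\nabla_XY$, $(d^{\nabla}J)(X,Y)=(\nabla_XJ)Y-(\nabla_YJ)X+J\,T^{\nabla}(X,Y)$, and $N_J(X,Y)=-J^2[X,Y]+J[X,JY]+J[JX,Y]-[JX,JY]$. *)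

(* Defs.v *)
From HB Require Import structures.
From mathcomp Require Import all_boot all_order all_algebra.
From mathcomp Require Import mathcomp_extra boolp classical_sets functions.
From mathcomp Require Import cardinality reals topology normedtype derive ring.

Set Implicit Arguments.
Unset Strict Implicit.
Unset Printing Implicit Defensive.

Import Order.TTheory GRing.Theory Num.Theory.
Import numFieldNormedType.Exports.

Local Open Scope classical_set_scope.
Local Open Scope ring_scope.

Section SmoothOnEuclideanSpace.
Context {R : realType} {m : nat}.
Implicit Types (U : set 'rV[R]_m) (f g : 'rV[R]_m -> R).

(* 'D_(delta_mx 0 i) is the i-th partial derivative; it is total, hence the
   explicit derivability condition. *)
Fixpoint Ck (k : nat) U f : Prop :=
  (forall x, U x -> {for x, continuous f}) /\
  if k is k'.+1 then
    forall i : 'I_m,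
      (forall x, U x -> derivable f x (delta_mx 0 i)) /\
      Ck k' U ('D_(delta_mx 0 i) f)
  else True.

Definition Cinfty U f : Prop := forall k, Ck k U f.

Lemma Ck_continuous k U f : Ck k U f -> forall x, U x -> {for x, continuous f}.
Proof. by case: k => [|k] []. Qed.

Lemma CkW k U f : Ck k.+1 U f -> Ck k U f.
Proof.
elim: k f => [|k IH] f; first by case.
case=> cf df; split=> // i; have [dfi Cfi] := df i.
by split=> //; exact: IH.
Qed.

Lemma eq_Ck k U f g : open U -> (forall x, U x -> f x = g x) ->
  Ck k U f -> Ck k U g.
Proof.
move=> oU; elim: k f g => [|k IH] f g fg [cf Df].
all: have nfg x : U x -> \forall y \near x, f y = g y
  by move=> Ux; apply: filterS (open_nbhs_nbhs (conj oU Ux)).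
all: split=> [x Ux|//].
1,2: change (g @ x --> g x); rewrite -(fg x Ux);
  by exact: cvg_trans (near_eq_cvg (nfg x Ux)) (cf x Ux).
move=> i; have [dfi Cfi] := Df i; split.
  by move=> x Ux; apply: near_eq_derivable (dfi x Ux); exact: nfg.
by apply: IH Cfi => x Ux; apply: near_eq_derive; exact: nfg.
Qed.

Lemma Ck_cst k U (c : R) : open U -> Ck k U (cst c).
Proof.
move=> oU; elim: k c => [|k IH] c; split=> //.
1,2: by move=> x _; exact: cst_continuous.
move=> i; split=> [x _|]; first exact: derivable_cst.
by apply: eq_Ck (IH 0) => // x _; rewrite derive_cst.
Qed.

Lemma CkD k U f g : open U -> Ck k U f -> Ck k U g -> Ck k U (f + g).
Proof.
move=> oU; elim: k f g => [|k IH] f g [cf Df] [cg Dg].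
all: split=> [x Ux|//]; do ?by apply: continuousD; [exact: cf|exact: cg].
move=> i; have [dfi Cfi] := Df i; have [dgi Cgi] := Dg i; split.
  by move=> x Ux; apply: derivableD; [exact: dfi|exact: dgi].
apply: eq_Ck (IH _ _ Cfi Cgi) => // x Ux.
by rewrite deriveD //; [exact: dfi|exact: dgi].
Qed.

Lemma CkM k U f g : open U -> Ck k U f -> Ck k U g -> Ck k U (f * g).
Proof.
move=> oU; elim: k f g => [|k IH] f g Cf Cg.
all: have cf := Ck_continuous Cf; have cg := Ck_continuous Cg.
all: split=> [x Ux|//]; do ?by apply: continuousM; [exact: cf|exact: cg].
move=> i; have [dfi Cfi] := Cf.2 i; have [dgi Cgi] := Cg.2 i; split.
  by move=> x Ux; apply: derivableM; [exact: dfi|exact: dgi].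
apply: eq_Ck (CkD oU (IH _ _ (CkW Cf) Cgi) (IH _ _ (CkW Cg) Cfi)) => // x Ux.
by rewrite deriveM //; [exact: dfi|exact: dgi].
Qed.

End SmoothOnEuclideanSpace.

(* A chart is a homeomorphism [chart_map] from the open set [chart_dom] of M
   onto the open set [chart_cod] of R^m, with inverse [chart_inv]; the values
   of the two total functions outside these sets are irrelevant. *)
Record chart (R : realType) (m : nat) (M : topologicalType) := Chart {
  chart_dom : set M ;
  chart_cod : set 'rV[R]_m ;
  chart_map : M -> 'rV[R]_m ;
  chart_inv : 'rV[R]_m -> M ;
  chart_dom_open : open chart_dom ;
  chart_cod_open : open chart_cod ;
  chart_mapP : forall p, chart_dom p -> chart_cod (chart_map p) ;
  chart_invP : forall x, chart_cod x -> chart_dom (chart_inv x) ;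
  chart_mapK : forall p, chart_dom p -> chart_inv (chart_map p) = p ;
  chart_invK : forall x, chart_cod x -> chart_map (chart_inv x) = x ;
  chart_map_continuous :
    forall p, chart_dom p -> {for p, continuous chart_map} ;
  chart_inv_continuous :
    forall x, chart_cod x -> {for x, continuous chart_inv}
}.

(* Smoothness of the transition map d o c^-1 on its domain of definition
   c(dom c `&` dom d). *)
Definition smooth_transition (R : realType) (m : nat) (M : topologicalType)
    (c d : chart R m M) : Prop :=
  forall i : 'I_m,
    Cinfty (chart_cod c `&` chart_inv c @^-1` chart_dom d)
           (fun x => chart_map d (chart_inv c x) 0 i).

(* The atlas need not be maximal: the smooth structure is the one that it
   generates. *)
Record smoothManifold (R : realType) (m : nat) := SmoothManifold {
  carrier :> topologicalType ;
  atlas : set (chart R m carrier) ;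
  manifold_hausdorff : hausdorff_space carrier ;
  manifold_second_countable : @second_countable carrier ;
  atlas_cover : forall p : carrier, exists2 c, atlas c & chart_dom c p ;
  atlas_compatible :
    forall c d, atlas c -> atlas d -> smooth_transition c d
}.

Section SmoothFunctions.
Context {R : realType} {m : nat} (M : smoothManifold R m).

Definition is_smooth (f : M -> R) : Prop :=
  forall c, atlas c -> Cinfty (chart_cod c) (f \o chart_inv c).

Lemma is_smooth_cst (a : R) : is_smooth (cst a).
Proof. by move=> c _ k; apply: Ck_cst; exact: chart_cod_open. Qed.

Lemma is_smoothD f g : is_smooth f -> is_smooth g -> is_smooth (f + g).
Proof.
move=> sf sg c Ac k.
by apply: CkD (sf c Ac k) (sg c Ac k); exact: chart_cod_open.
Qed.

Lemma is_smoothM f g : is_smooth f -> is_smooth g -> is_smooth (f * g).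
Proof.
move=> sf sg c Ac k.
by apply: CkM (sf c Ac k) (sg c Ac k); exact: chart_cod_open.
Qed.

Lemma is_smoothN f : is_smooth f -> is_smooth (- f).
Proof.
move=> sf; suff -> : - f = cst (-1) * f.
  by apply: is_smoothM => //; exact: is_smooth_cst.
by apply/funext => p; rewrite /GRing.mul /= /cst mulN1r.
Qed.

Lemma is_smoothB f g : is_smooth f -> is_smooth g -> is_smooth (f - g).
Proof. by move=> sf sg; apply: is_smoothD => //; exact: is_smoothN. Qed.

Definition smooth_pred : {pred M -> R} := mem (is_smooth : set (M -> R)).

Lemma smooth_subring_closed : subring_closed smooth_pred.
Proof.
split=> [|f g|f g]; rewrite !inE.
- exact: is_smooth_cst.
- exact: is_smoothB.
- exact: is_smoothM.
Qed.

Record smoothFun := SmoothFun {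
  smooth_fun :> M -> R ;
  smooth_funP : smooth_fun \in smooth_pred
}.

HB.instance Definition _ := [isSub for smooth_fun].
HB.instance Definition _ := [Choice of smoothFun by <:].
HB.instance Definition _ :=
  GRing.SubChoice_isSubComPzRing.Build (M -> R) smooth_pred smoothFun
    smooth_subring_closed.

Definition mk_smooth (f : M -> R) (sf : is_smooth f) : smoothFun :=
  SmoothFun (mem_set sf).

Definition smooth_cst (a : R) : smoothFun := mk_smooth (is_smooth_cst a).

Lemma smoothP (f : smoothFun) : is_smooth f.
Proof. exact: set_mem (smooth_funP f). Qed.

Lemma smooth_eqP (f g : smoothFun) : (forall p, f p = g p) -> f = g.
Proof. by move=> fg; apply: val_inj; apply/funext. Qed.

End SmoothFunctions.

Section TangentVectors.
Context {R : realType} {m : nat} (M : smoothManifold R m).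

(* The tangent space at p is the space of derivations at p of the algebra of
   global smooth functions; since M is Hausdorff, bump functions exist, so
   this agrees with derivations of germs. *)
Record tangent (p : M) := Tangent {
  tangent_fun :> smoothFun M -> R ;
  tangentD : forall f g, tangent_fun (f + g) = tangent_fun f + tangent_fun g ;
  tangentZ : forall (a : R) f,
    tangent_fun (smooth_cst M a * f) = a * tangent_fun f ;
  tangentM : forall f g,
    tangent_fun (f * g) = f p * tangent_fun g + g p * tangent_fun f
}.

Variable p : M.
Implicit Types u v w : tangent p.

Lemma tangent_eqP u v : (forall f, u f = v f) -> u = v.
Proof.
case: u v => [u uD uZ uM] [v vD vZ vM] /= /funext uv.
by move: uD uZ uM; rewrite uv => uD uZ uM; congr Tangent; exact: Prop_irrelevance.
Qed.

HB.instance Definition _ := gen_eqMixin (tangent p).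
HB.instance Definition _ := gen_choiceMixin (tangent p).

Program Definition tangent_zero : tangent p := @Tangent p (fun=> 0) _ _ _.
Next Obligation. by move=> * /=; rewrite addr0. Qed.
Next Obligation. by move=> * /=; rewrite mulr0. Qed.
Next Obligation. by move=> * /=; rewrite !mulr0 addr0. Qed.

Program Definition tangent_opp u : tangent p :=
  @Tangent p (fun f => - u f) _ _ _.
Next Obligation. by move=> * /=; rewrite tangentD opprD. Qed.
Next Obligation. by move=> * /=; rewrite tangentZ mulrN. Qed.
Next Obligation. by move=> * /=; rewrite tangentM !mulrN opprD. Qed.

Program Definition tangent_add u v : tangent p :=
  @Tangent p (fun f => u f + v f) _ _ _.
Next Obligation. by move=> * /=; rewrite !tangentD addrACA. Qed.
Next Obligation. by move=> * /=; rewrite !tangentZ mulrDr. Qed.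
Next Obligation. by move=> * /=; rewrite !tangentM !mulrDr addrACA. Qed.

Program Definition tangent_scale (a : R) u : tangent p :=
  @Tangent p (fun f => a * u f) _ _ _.
Next Obligation. by move=> * /=; rewrite tangentD mulrDr. Qed.
Next Obligation. by move=> * /=; rewrite tangentZ mulrCA. Qed.
Next Obligation. by move=> a u f g /=; rewrite tangentM mulrDr !(mulrCA a). Qed.

Lemma tangent_addA : associative tangent_add.
Proof. by move=> u v w; apply: tangent_eqP => f /=; rewrite addrA. Qed.
Lemma tangent_addC : commutative tangent_add.
Proof. by move=> u v; apply: tangent_eqP => f /=; rewrite addrC. Qed.
Lemma tangent_add0 : left_id tangent_zero tangent_add.
Proof. by move=> u; apply: tangent_eqP => f /=; rewrite add0r. Qed.
Lemma tangent_addN : left_inverse tangent_zero tangent_opp tangent_add.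
Proof. by move=> u; apply: tangent_eqP => f /=; rewrite addNr. Qed.

HB.instance Definition _ := GRing.isZmodule.Build (tangent p)
  tangent_addA tangent_addC tangent_add0 tangent_addN.

Lemma tangent_scaleA a b u :
  tangent_scale a (tangent_scale b u) = tangent_scale (a * b) u.
Proof. by apply: tangent_eqP => f /=; rewrite mulrA. Qed.
Lemma tangent_scale1 : left_id 1 tangent_scale.
Proof. by move=> u; apply: tangent_eqP => f /=; rewrite mul1r. Qed.
Lemma tangent_scaleDr : right_distributive tangent_scale +%R.
Proof. by move=> a u v; apply: tangent_eqP => f /=; rewrite mulrDr. Qed.
Lemma tangent_scaleDl u : {morph tangent_scale^~ u : a b / a + b}.
Proof. by move=> a b; apply: tangent_eqP => f /=; rewrite mulrDl. Qed.

HB.instance Definition _ := GRing.Zmodule_isLmodule.Build R (tangent p)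
  tangent_scaleA tangent_scale1 tangent_scaleDr tangent_scaleDl.

End TangentVectors.

Section VectorFields.
Context {R : realType} {m : nat} (M : smoothManifold R m).

Record vectorField := VectorField {
  vf_at :> forall p : M, tangent p ;
  vf_smooth : forall f : smoothFun M, is_smooth (fun p => vf_at p f)
}.
Implicit Types X Y Z : vectorField.

Lemma vf_eqP X Y : (forall p f, X p f = Y p f) -> X = Y.
Proof.
case: X Y => [X sX] [Y sY] /= XY.
have {}XY : X = Y by apply/functional_extensionality_dep => p; exact: tangent_eqP.
by move: sX; rewrite XY => sX; congr VectorField; exact: Prop_irrelevance.
Qed.

HB.instance Definition _ := gen_eqMixin vectorField.
HB.instance Definition _ := gen_choiceMixin vectorField.

Definition vf_zero : vectorField :=
  @VectorField (fun p => 0) (fun f => @is_smooth_cst R m M 0).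

Definition vf_opp X : vectorField :=
  @VectorField (fun p => - X p) (fun f => is_smoothN (vf_smooth X f)).

Definition vf_add X Y : vectorField :=
  @VectorField (fun p => X p + Y p)
    (fun f => is_smoothD (vf_smooth X f) (vf_smooth Y f)).

Definition vf_scale (g : smoothFun M) X : vectorField :=
  @VectorField (fun p => g p *: X p)
    (fun f => is_smoothM (smoothP g) (vf_smooth X f)).

Lemma vf_addA : associative vf_add.
Proof. by move=> X Y Z; apply: vf_eqP => p f /=; rewrite addrA. Qed.
Lemma vf_addC : commutative vf_add.
Proof. by move=> X Y; apply: vf_eqP => p f /=; rewrite addrC. Qed.
Lemma vf_add0 : left_id vf_zero vf_add.
Proof. by move=> X; apply: vf_eqP => p f /=; rewrite add0r. Qed.
Lemma vf_addN : left_inverse vf_zero vf_opp vf_add.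
Proof. by move=> X; apply: vf_eqP => p f /=; rewrite addNr. Qed.

HB.instance Definition _ := GRing.isZmodule.Build vectorField
  vf_addA vf_addC vf_add0 vf_addN.

Lemma vf_scaleA g h X : vf_scale g (vf_scale h X) = vf_scale (g * h) X.
Proof. by apply: vf_eqP => p f /=; rewrite mulrA. Qed.
Lemma vf_scale1 : left_id 1 vf_scale.
Proof. by move=> X; apply: vf_eqP => p f /=; rewrite mul1r. Qed.
Lemma vf_scaleDr : right_distributive vf_scale +%R.
Proof. by move=> g X Y; apply: vf_eqP => p f /=; rewrite mulrDr. Qed.
Lemma vf_scaleDl X : {morph vf_scale^~ X : g h / g + h}.
Proof. by move=> g h; apply: vf_eqP => p f /=; rewrite mulrDl. Qed.

HB.instance Definition _ := GRing.Zmodule_isLmodule.Build (smoothFun M)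
  vectorField vf_scaleA vf_scale1 vf_scaleDr vf_scaleDl.

Definition vf_act X (f : smoothFun M) : smoothFun M :=
  mk_smooth (vf_smooth X f).

Lemma vf_actD X f g : vf_act X (f + g) = vf_act X f + vf_act X g.
Proof. by apply: smooth_eqP => p /=; rewrite tangentD. Qed.

Lemma vf_actZ X (a : R) f :
  vf_act X (smooth_cst M a * f) = smooth_cst M a * vf_act X f.
Proof. by apply: smooth_eqP => p /=; rewrite tangentZ. Qed.

Lemma vf_actM X f g : vf_act X (f * g) = f * vf_act X g + g * vf_act X f.
Proof. by apply: smooth_eqP => p /=; rewrite tangentM. Qed.

Program Definition bracket_at X Y (p : M) : tangent p :=
  @Tangent _ _ M p (fun f => X p (vf_act Y f) - Y p (vf_act X f)) _ _ _.
Next Obligation.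
by move=> * /=; rewrite !vf_actD !tangentD opprD addrACA.
Qed.
Next Obligation. by move=> * /=; rewrite !vf_actZ !tangentZ mulrBr. Qed.
Next Obligation.
by move=> X Y p f g /=; rewrite !vf_actM !tangentD !tangentM /=; ring.
Qed.

Definition lie_bracket X Y : vectorField :=
  @VectorField (bracket_at X Y)
    (fun f => is_smoothB (vf_smooth X (vf_act Y f)) (vf_smooth Y (vf_act X f))).

End VectorFields.

Section TensorsAndConnections.
Context {R : realType} {m : nat} (M : smoothManifold R m).
Implicit Types X Y Z : vectorField M.

(* A (1,1)-tensor field is a field of endomorphisms of the tangent spaces;
   it is smooth when it maps smooth vector fields to smooth vector fields. *)
Record tensor11 := Tensor11 {
  tensor_at : forall p : M, {linear tangent p -> tangent p} ;
  tensor_smooth : forall X (f : smoothFun M),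
    is_smooth (fun p => tensor_at p (X p) f)
}.

Definition tensor_app (J : tensor11) X : vectorField M :=
  @VectorField _ _ M (fun p => tensor_at J p (X p)) (tensor_smooth J X).

Definition almost_complex (J : tensor11) : Prop :=
  forall (p : M) (v : tangent p), tensor_at J p (tensor_at J p v) = - v.

(* Homogeneity in the second argument over real constants is the case of
   constant f in the Leibniz rule. *)
Record linearConnection := LinearConnection {
  nabla :> vectorField M -> vectorField M -> vectorField M ;
  nablaDl : forall X Y Z, nabla (X + Y) Z = nabla X Z + nabla Y Z ;
  nablaZl : forall (f : smoothFun M) X Z, nabla (f *: X) Z = f *: nabla X Z ;
  nablaDr : forall X Y Z, nabla X (Y + Z) = nabla X Y + nabla X Z ;
  nabla_leibniz : forall (f : smoothFun M) X Y,
    nabla X (f *: Y) = f *: nabla X Y + vf_act X f *: Y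
}.

End TensorsAndConnections.

Coercion tensor_app : tensor11 >-> Funclass.

Notation "[| X , Y |]" := (lie_bracket X Y)
  (at level 0, X, Y at level 99, format "[| X ,  Y |]") : ring_scope.

Section TorsionAndNijenhuis.
Context {R : realType} {m : nat} {M : smoothManifold R m}.
Implicit Types (D : linearConnection M) (J : tensor11 M) (X Y : vectorField M).

Definition torsion D X Y : vectorField M := D X Y - D Y X - [| X, Y |].

(* cov_tensor D J X Y is (D_X J) Y. *)
Definition cov_tensor D J X Y : vectorField M := D X (J Y) - J (D X Y).

Definition d_nabla D J X Y : vectorField M :=
  cov_tensor D J X Y - cov_tensor D J Y X + J (torsion D X Y).

Definition nijenhuis J X Y : vectorField M :=
  - J (J [| X, Y |]) + J [| X, J Y |] + J [| J X, Y |] - [| J X, J Y |].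

End TorsionAndNijenhuis.

(* Main.v *)
(* Expanding the torsion, the hypothesis becomes the torsion-free identity
   J[X,Y] = D_X(JY) - D_Y(JX).  Used for (X,Y), and for (JX,JY) together with
   J^2 = -id, it cancels every covariant derivative in
   N_J(X,Y) + J(T(X,JY) + T(JX,Y)). *)

Require Import Defs.
From HB Require Import structures.
From mathcomp Require Import all_boot all_order all_algebra reals ring.

Import GRing.Theory.

Local Open Scope ring_scope.

(** Pointwise linearity lifts to fields; this registers [J] as additive, so that the [raddf] lemmas
    apply to it. *)
Lemma tensor_app_is_zmod_morphism (R : realType) (m : nat)
    (M : smoothManifold R m) (J : tensor11 M) : zmod_morphism (tensor_app J).
Proof. by move=> X Y; apply: vf_eqP => p f /=; rewrite linearB. Qed.

HB.instance Definition _ (R : realType) (m : nat) (M : smoothManifold R m)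
    (J : tensor11 M) :=
  GRing.isZmodMorphism.Build (vectorField M) (vectorField M) (tensor_app J)
    (@tensor_app_is_zmod_morphism R m M J).

Lemma tensor_appK {R : realType} {m : nat} {M : smoothManifold R m}
    {J : tensor11 M} (hJ : almost_complex J) (X : vectorField M) :
  J (J X) = - X.
Proof. by apply: vf_eqP => p f /=; rewrite hJ. Qed.

Lemma nablaNr {R : realType} {m : nat} {M : smoothManifold R m}
    (D : linearConnection M) (X Y : vectorField M) : D X (- Y) = - D X Y.
Proof.
have D0 : D X 0 = 0 by apply: (addrI (D X 0)); rewrite -nablaDr !addr0.
by apply: (addrI (D X Y)); rewrite -nablaDr !subrr.
Qed.

(** The terms [J (D X Y)] and [J (D Y X)] of the two covariant derivatives of [J] cancel those in
    [J (torsion D X Y)]. *)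
Lemma d_nablaE {R : realType} {m : nat} {M : smoothManifold R m}
    (D : linearConnection M) (J : tensor11 M) (X Y : vectorField M) :
  d_nabla D J X Y = D X (J Y) - D Y (J X) - J [| X, Y |].
Proof.
rewrite /d_nabla /cov_tensor /torsion !raddfB /=.
move: (D X (J Y)) (D Y (J X)) (J (D X Y)) (J (D Y X)) (J _) => a b c d e.
by apply: vf_eqP => p f /=; ring.
Qed.

Theorem lemma1 (R : realType) (n : nat) (N : smoothManifold R (2 * n))
    (D : linearConnection N) (J : tensor11 N) (hJ : almost_complex J)
    (hd : forall X Y : vectorField N, d_nabla D J X Y = 0) :
  forall X Y : vectorField N,
    nijenhuis J X Y = - J (torsion D X (J Y) + torsion D (J X) Y).
Proof.
move=> X Y.
have J_bracket Z W : J [| Z, W |] = D Z (J W) - D W (J Z).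
  by apply/esym/subr0_eq; rewrite -d_nablaE.
have bracketJ : [| J X, J Y |] = J (D (J X) Y - D (J Y) X).
  (* Write the bracket as [- J (J [| J X, J Y |])] and apply [J_bracket] to its inner [J]. *)
  rewrite -[LHS]opprK -(tensor_appK hJ [| _, _ |]) J_bracket !(tensor_appK hJ).
  by rewrite !nablaNr opprK addrC -raddfN opprB.
rewrite /nijenhuis bracketJ (J_bracket X Y) /torsion !raddfD !raddfN /=.
(* Both sides are now additive combinations of six fields; evaluated at [p] on [f], they are
   compared in [R]. *)
move: (J (D X (J Y))) (J (D Y (J X))) (J [| X, J Y |]) (J [| J X, Y |]).
move: (J (D (J X) Y)) (J (D (J Y) X)) => a b c d e g.
by apply: vf_eqP => p f /=; ring.
Qed.
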